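(* Consider the symmetric moment problem given by $$b_{2n}^*=\sqrt{3n+1}\,(3n+2)\ \ (n\ge0),\qquad b_{2n-1}^*=3n\sqrt{3n+1}\ \ (n\ge1),$$ with associated moments $s_n^*$, numbers $c_n^*$ and coefficients $a_{j,k}^*$. Then $$\sum_{n=0}^\infty c_{2n}^*s_{2n}^*=\infty,$$ so property (cs) does not hold. Moreover the series $$\sum_{l=0}^\infty a_{2k,2l}^*\,s_{2l+2m}^*$$ is not absolutely convergent for $k\ge0$, $m\ge1$, so property (ac) does not hold.
   Context: Given positive numbers $(b_n)_{n\ge0}$, let $P_{-1}=0$, $P_0=1$ and $xP_n(x)=b_nP_{n+1}(x)+b_{n-1}P_{n-1}(x)$, $n\ge0$ (the value of $b_{-1}$ is irrelevant). There is a probability measure $\mu$ on $\mathbb{R}$ with infinite support and all moments for which $(P_n)$ are the orthonormal polynomials; its moments $s_n=\int x^n\,d\mu$ depend only on $(b_n)$. The associated Hamburger moment problem is the symmetric moment problem given by $(b_n)$; it is indeterminate if more than one measure has the moments $(s_n)$. For $b_n=b_n^*$ it is known to be indeterminate (it is the symmetrization of the Stieltjes problem of the birth-and-death process with rates $\lambda_n=(3n+1)(3n+2)^2$, $\mu_n=(3n)^2(3n+1)$, i.e. $b^*_{2n}=\sqrt{\lambda_n}$, $b^*_{2n-1}=\sqrt{\mu_n}$). In the indeterminate case write $P_n(x)=\sum_{k=0}^n b_{k,n}x^k$ and $\sum_{n=0}^\infty P_n(z)P_n(w)=\sum_{j,k\ge0}a_{j,k}z^jw^k$ (entire in two variables),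 so $a_{k,l}=\sum_{n\ge\max(k,l)}b_{k,n}b_{l,n}$, and $c_k=\sqrt{a_{k,k}}$. A star denotes these quantities for $b_n=b_n^*$. Property (cs): $\sum_{n=0}^\infty c_{2n}s_{2n}<\infty$. Property (ac): for all $i,j\ge0$ the series $\sum_{k=0}^\infty a_{i,k}s_{k+j}$ is absolutely convergent. *)

(* Defs.v *)
From HB Require Import structures.
From mathcomp Require Import all_boot all_order all_algebra.
From mathcomp Require Import all_classical all_reals all_analysis.
Set Implicit Arguments.
Unset Strict Implicit.
Unset Printing Implicit Defensive.
Import Order.TTheory GRing.Theory Num.Theory numFieldNormedType.Exports.
Local Open Scope classical_set_scope.
Local Open Scope ring_scope.

(* b_n P_{n+1} = x P_n - b_{n-1} P_{n-1}, with P_0 = 1 and P_{-1} = 0. *)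
Fixpoint orthP (R : realType) (b : nat -> R) (n : nat) : {poly R} :=
  match n with
  | 0 => 1
  | n'.+1 =>
      (b n')^-1 *: ('X * orthP b n' -
        match n' with
        | 0 => 0
        | n''.+1 => b n'' *: orthP b n''
        end)
  end.

Lemma orthP_rec (R : realType) (b : nat -> R) (b_gt0 : forall n, 0 < b n) n :
  'X * orthP b n =
  b n *: orthP b n.+1 + (if n is m.+1 then b m *: orthP b m else 0).
Proof.
by case: n => [|n] /=; rewrite scalerA divff ?gt_eqF// scale1r subrK.
Qed.

(* [mu] has moments of every order and the polynomials [orthP b n] are
   orthonormal in L^2(mu); this forces the support of [mu] to be infinite. *)
Definition orthonormal_measure (R : realType) (b : nat -> R)
    (mu : probability (measurableTypeR R) R) : Prop :=
  (forall n, mu.-integrable setT (fun x : R => (x ^+ n)%:E)) /\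
  (forall m n, \int[mu]_x ((orthP b m).[x] * (orthP b n).[x]) = (m == n)%:R).

Definition moment (R : realType) (mu : probability (measurableTypeR R) R)
    (n : nat) : R :=
  \int[mu]_x (x ^+ n).

(* Coefficient of z^k w^l in sum_n P_n(z) P_n(w).  The series converges when
   the moment problem given by [b] is indeterminate. *)
Definition kcoef (R : realType) (b : nat -> R) (k l : nat) : R :=
  \big[+%R/0]_(maxn k l <= n <oo) ((orthP b n)`_k * (orthP b n)`_l).

Definition ccoef (R : realType) (b : nat -> R) (k : nat) : R :=
  Num.sqrt (kcoef b k k).

Definition abs_convergent (R : realType) (u : nat -> R) : Prop :=
  cvgn [normed series u].

(* The sum is taken in the extended reals; its terms are nonnegative when [s]
   is the moment sequence of a measure. *)
Definition cs_sum (R : realType) (b s : nat -> R) : \bar R :=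
  (\sum_(0 <= n <oo) (ccoef b n.*2 * s n.*2)%:E)%E.

Definition property_cs (R : realType) (b s : nat -> R) : Prop :=
  (cs_sum b s < +oo)%E.

Definition property_ac (R : realType) (b s : nat -> R) : Prop :=
  forall i j : nat, abs_convergent (fun k => kcoef b i k * s (k + j)%N).

(* [uphalf n] is the index called n in both cases of the formula for b*:
   uphalf (2n) = uphalf (2n - 1) = n. *)
Definition bstar (R : realType) (m : nat) : R :=
  let n := uphalf m in
  if odd m then (3 * n)%:R * Num.sqrt (3 * n + 1)%:R
  else Num.sqrt (3 * n + 1)%:R * (3 * n + 2)%:R.

Lemma bstar_even (R : realType) (n : nat) :
  bstar R n.*2 = Num.sqrt (3 * n + 1)%:R * (3 * n + 2)%:R.
Proof. by rewrite /bstar odd_double uphalf_double. Qed.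

Lemma bstar_odd (R : realType) (n : nat) (n_gt0 : (1 <= n)%N) :
  bstar R (n.*2 - 1) = (3 * n)%:R * Num.sqrt (3 * n + 1)%:R.
Proof.
case: n n_gt0 => // n _.
by rewrite /bstar doubleS subn1 /= odd_double /= doubleK.
Qed.

Lemma bstar_gt0 (R : realType) (m : nat) : 0 < bstar R m.
Proof.
rewrite /bstar; case: ifP => [|_]; last first.
  by rewrite mulr_gt0 ?sqrtr_gt0 ?ltr0n ?addn1 ?addn2.
by case: m => // m _; rewrite mulr_gt0 ?sqrtr_gt0 ?ltr0n ?addn1 ?muln_gt0.
Qed.

(* Main.v *)
Require Import Defs.
From HB Require Import structures.
From mathcomp Require Import all_boot all_order all_algebra.
From mathcomp Require Import all_classical all_reals all_analysis.
From mathcomp Require Import ring lra.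
Import Order.TTheory GRing.Theory Num.Theory numFieldNormedType.Exports.
Local Open Scope classical_set_scope.
Local Open Scope ring_scope.

(* Let |P_n| be P_n with its coefficients replaced by their absolute values.
   The signs of P_n alternate, so |a_{2k,2l}| = sum_n |b_{2k,2n}| |b_{2l,2n}|
   and, by Tonelli, sum_l |a_{2k,2l}| s_{2l} = sum_n |b_{2k,2n}| L(|P_{2n}|),
   where L is integration against mu. For the rates b* the expansion
     |P_{2n}| = sum_k sqrt((3n+1)/(3k+1)) (k+1/3)_{n-k}/(n-k)! P_{2k}
   holds (on generating functions it is the substitution v = u/(1-u^3)^(1/3),
   which carries du/(1-u^3)^(2/3) to dv/(1+v^3)^(2/3)), whence
   L(|P_{2n}|) = sqrt(3n+1) (1/3)_n/n!. Moreover
   |b_{0,2n}| = (2/3)_n/n!/sqrt(3n+1), and |b_{2k,2n}|/|b_{0,2n}| is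
   nondecreasing in n and bounded. The double series therefore dominates a
   multiple of sum_n (1/3)_n(2/3)_n/n!^2, whose terms are of order 1/n.
   Property (cs) fails because c_0 c_{2l} >= |a_{0,2l}|, and (ac) because
   s_{2l+2m} >= s_{2l}. *)

(** * Polynomials of the three-term recurrence with either sign *)

Fixpoint signedP_rec (R : realType) (s : R) (b : nat -> R) (n : nat) : {poly R} :=
  match n with
  | 0 => 1
  | n'.+1 =>
      (b n')^-1 *: ('X * signedP_rec R s b n' +
        match n' with
        | 0 => 0
        | n''.+1 => (s * b n'') *: signedP_rec R s b n''
        end)
  end.

(* The sign [s = -1] gives [orthP b]; [s = 1] gives the polynomials
   (-i)^n P_n(i x), whose coefficients are the absolute values of those of
   P_n. Locked, because [*:] and polynomial products would otherwise unify
   with the body. *)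
HB.lock Definition signedP (R : realType) (s : R) (b : nat -> R) (n : nat) :
  {poly R} := signedP_rec R s b n.
Arguments signedP {R} s b n.

Lemma nat_ind2 (Q : nat -> Prop) :
  Q 0%N -> Q 1%N -> (forall n, Q n -> Q n.+1 -> Q n.+2) -> forall n, Q n.
Proof.
move=> Q0 Q1 QS n; suff: Q n /\ Q n.+1 by case.
by elim: n => // n [Qn QSn]; split=> //; apply: QS.
Qed.

Section SignedP.
Variables (R : realType) (s : R) (b : nat -> R).
Hypothesis b_gt0 : forall n, 0 < b n.

Lemma signedP0 : signedP s b 0 = 1.
Proof. by rewrite signedP.unlock. Qed.

Lemma signedPS0 : signedP s b 1 = (b 0)^-1 *: 'X.
Proof. by rewrite signedP.unlock /= mulr1 addr0. Qed.

Lemma signedPSS n : signedP s b n.+2 =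
  (b n.+1)^-1 *: ('X * signedP s b n.+1 + (s * b n) *: signedP s b n).
Proof. by rewrite signedP.unlock. Qed.

Lemma mulX_signedP n :
  'X * signedP s b n.+1 = b n.+1 *: signedP s b n.+2 - (s * b n) *: signedP s b n.
Proof. by rewrite signedPSS scalerA divff ?gt_eqF// scale1r addrK. Qed.

Lemma coef_signedPSS n k : (signedP s b n.+2)`_k =
  (b n.+1)^-1 * ((if k is k'.+1 then (signedP s b n.+1)`_k' else 0) +
                 s * b n * (signedP s b n)`_k).
Proof.
rewrite signedPSS coefZ coefD coefXM (coefZ (s * b n)).
by case: k.
Qed.

Lemma size_signedP n : (size (signedP s b n) <= n.+1)%N.
Proof.
elim/nat_ind2: n => [||n IH0 IH1]; first by rewrite signedP0 size_polyC leq_b1.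
  by rewrite signedPS0 (leq_trans (size_scale_leq _ _))// size_polyX.
rewrite signedPSS (leq_trans (size_scale_leq _ _))//.
rewrite (leq_trans (size_polyD _ _))// geq_max; apply/andP; split.
  by rewrite (leq_trans (size_polyMleq _ _))// size_polyX.
by rewrite (leq_trans (size_scale_leq _ _))// (leq_trans IH0)// leqW.
Qed.

Lemma signedP_parity n k : odd (n + k) -> (signedP s b n)`_k = 0.
Proof.
elim/nat_ind2: n k => [||n IH0 IH1] k.
- by rewrite signedP0 coefC; case: k.
- by rewrite signedPS0 coefZ coefX; case: k => [|[|k]] //=; rewrite mulr0.
- rewrite coef_signedPSS => nk.
  have nk' : odd (n + k) by move: nk; rewrite !addSn /= negbK.
  rewrite (IH0 _ nk') mulr0 addr0; case: k nk {nk'} => [|k] nk.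
    by rewrite mulr0.
  by rewrite IH1 ?mulr0//; move: nk; rewrite !addSn addnS /= !negbK.
Qed.

End SignedP.

Lemma orthP_signedP (R : realType) (b : nat -> R) : orthP b =1 signedP (-1) b.
Proof.
elim/nat_ind2=> [||n IH0 IH1]; first by rewrite signedP0.
  by rewrite signedPS0 /= subr0 mulr1.
by rewrite signedPSS -IH0 -IH1 mulN1r scaleNr.
Qed.

(** * Signs and absolute values of the coefficients *)

Notation absP := (signedP 1).

Section AbsP.
Variables (R : realType) (b : nat -> R).
Hypothesis b_gt0 : forall n, 0 < b n.

Lemma absP_ge0 n k : 0 <= (absP b n)`_k.
Proof.
have bV n' : 0 <= (b n')^-1 by rewrite invr_ge0 ltW.
elim/nat_ind2: n k => [||n IH0 IH1] k.
- by rewrite signedP0 coefC; case: ifP.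
- by rewrite signedPS0 coefZ coefX mulr_ge0 ?ler0n.
- rewrite coef_signedPSS mul1r mulr_ge0 ?addr_ge0//; first by case: k.
  by rewrite mulr_ge0 // ltW.
Qed.

Lemma absP_lead_gt0 n : 0 < (absP b n)`_n.
Proof.
elim/nat_ind2: n => [||n IH0 IH1]; first by rewrite signedP0 coefC.
  by rewrite signedPS0 coefZ coefX mulr1 invr_gt0.
rewrite coef_signedPSS mul1r pmulr_rgt0 ?invr_gt0//.
by rewrite ltr_wpDr// mulr_ge0 ?absP_ge0// ltW.
Qed.

(* The exponent is (n - k)/2 modulo 2 when n and k have the same parity; for
   the other k both coefficients vanish. *)
Lemma coef_orthP n k :
  (orthP b n)`_k = (-1) ^+ ((n + k)./2 + k) * (absP b n)`_k.
Proof.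
rewrite orthP_signedP; elim/nat_ind2: n k => [||n IH0 IH1] k.
- by rewrite !signedP0 !coefC; case: k => [|k] /=; rewrite ?mulr0// mulr1.
- rewrite !signedPS0 !coefZ !coefX.
  by case: k => [|[|k]]; rewrite ?mulr0//= !exprS expr0 !mulN1r opprK mul1r.
- rewrite !coef_signedPSS IH0 [RHS]mulrCA; congr (_ * _).
  rewrite mul1r mulrDr; congr (_ + _).
    case: k => [|k]; rewrite ?mulr0// IH1 !addSn addnS/= addnS/=.
    by rewrite !exprS !mulN1r opprK.
  by rewrite !addSn /= exprS; ring.
Qed.

(** The sign is independent of n, so the series for a_{2k,2l} has no cancellation. *)
Lemma coef_orthP_even n k l :
  (orthP b n)`_k.*2 * (orthP b n)`_l.*2 =
  (-1) ^+ (k + l) * ((absP b n)`_k.*2 * (absP b n)`_l.*2).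
Proof.
rewrite !coef_orthP mulrACA -exprD; congr (_ * _).
suff E : odd ((n + k.*2)./2 + k.*2 + ((n + l.*2)./2 + l.*2)) = odd (k + l).
  by rewrite -[LHS]signr_odd E signr_odd.
rewrite !halfD !odd_double !andbF !add0n !doubleK !oddD !odd_double !addbF.
by case: (odd n./2); case: (odd k); case: (odd l).
Qed.

End AbsP.

(** * The rates [bstar]: rational recurrences and the connection formula *)

HB.lock Definition evenP (R : realType) (s : R) (n : nat) : {poly R} :=
  (Num.sqrt (3 * n%:R + 1))^-1 *: signedP s (bstar R) n.*2.
Arguments evenP {R} s n.

Definition oddP (R : realType) (s : R) (n : nat) : {poly R} :=
  signedP s (bstar R) n.*2.+1.
Arguments oddP {R} s n.

Section Connection.
Variable R : realType.
Implicit Type s : R.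

Lemma sqrt3D1_gt0 n : 0 < Num.sqrt (3 * n%:R + 1 : R).
Proof. by rewrite sqrtr_gt0 ltr_wpDl// mulr_ge0. Qed.

Lemma sqr_sqrt3D1 n : Num.sqrt (3 * n%:R + 1 : R) ^+ 2 = 3 * n%:R + 1.
Proof. by rewrite sqr_sqrtr// addr_ge0// mulr_ge0. Qed.

Lemma bstar_doubleE n :
  bstar R n.*2 = (3 * n%:R + 2) * Num.sqrt (3 * n%:R + 1).
Proof. by rewrite bstar_even (natrD _ _ 1) (natrD _ _ 2) natrM mulrC. Qed.

Lemma bstar_doubleSE n :
  bstar R n.*2.+1 = (3 * n%:R + 3) * Num.sqrt (3 * n.+1%:R + 1).
Proof.
have := @bstar_odd R n.+1 isT; rewrite doubleS subn1 /= => ->.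
by rewrite (natrD _ _ 1) natrM; congr (_ * _); ring.
Qed.

Lemma signedP_even s n :
  signedP s (bstar R) n.*2 = Num.sqrt (3 * n%:R + 1) *: evenP s n.
Proof. by rewrite evenP.unlock scalerA divff ?scale1r// gt_eqF// sqrt3D1_gt0. Qed.

Lemma evenP0 s : evenP s 0 = 1.
Proof. by rewrite evenP.unlock mulr0 add0r sqrtr1 invr1 scale1r signedP0. Qed.

(** The factor 1/sqrt(3n+1) in [evenP] cancels the square roots of the rates, so this recurrence and
    [oddP_rec] have coefficients polynomial in n. At n = 0 the term with [n.-1] has coefficient
    0. *)
Lemma evenP_rec s n :
  'X * evenP s n = (3 * n%:R + 2) *: oddP s n - (s * (3 * n%:R)) *: oddP s n.-1.
Proof.
rewrite evenP.unlock -scalerAr; case: n => [|n].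
  rewrite !mulr0 scale0r subr0 !add0r sqrtr1 invr1 scale1r signedP0 mulr1.
  rewrite /oddP signedPS0 scalerA (bstar_doubleE 0) mulr0 !add0r sqrtr1 mulr1.
  by rewrite divff ?scale1r// pnatr_eq0.
rewrite doubleS mulX_signedP; last exact: bstar_gt0.
have /gt_eqF/negbT s0 := sqrt3D1_gt0 n.+1.
rewrite -doubleS bstar_doubleE bstar_doubleSE scalerBr !scalerA -!/(oddP _ _).
set q := Num.sqrt _ in s0 *.
have -> : q^-1 * ((3 * n.+1%:R + 2) * q) = 3 * n.+1%:R + 2 by field.
by have -> : q^-1 * (s * ((3 * n%:R + 3) * q)) = s * (3 * n.+1%:R) by field.
Qed.

Lemma oddP_rec s n :
  'X * oddP s n = ((3 * n%:R + 3) * (3 * n%:R + 4)) *: evenP s n.+1 -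
    (s * ((3 * n%:R + 1) * (3 * n%:R + 2))) *: evenP s n.
Proof.
rewrite /oddP mulX_signedP; last exact: bstar_gt0.
rewrite -doubleS !signedP_even bstar_doubleE bstar_doubleSE !scalerA.
rewrite -[_ * _ * _ in X in X - _]mulrA -[_ * _ * _ in X in _ - X]mulrA.
rewrite -(mulrA (3 * n%:R + 2)) -!expr2 !sqr_sqrt3D1.
congr (_ *: _ - _ *: _); last by rewrite (mulrC (3 * n%:R + 2)).
by congr (_ * _); ring.
Qed.

(* The coefficients expanding |P_{2n}| and |P_{2n+1}| in the P_{2k} and
   P_{2k+1}. In closed form [conn n k] is the Pochhammer quotient
   (k + 1/3)_(n - k) / (n - k)!, which vanishes for k > n. *)
Fixpoint conn (n k : nat) : R :=
  match n, k with
  | 0, 0 => 1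
  | 0, _.+1 => 0
  | n'.+1, 0 => (3 * n'%:R + 1) / (3 * n'%:R + 3) * conn n' 0
  | n'.+1, k'.+1 => (3 * n'%:R + 1) / (3 * k'%:R + 1) * conn n' k'
  end.

Lemma connS0E n :
  conn n.+1 0 = (3 * n%:R + 1) / (3 * n%:R + 3) * conn n 0.
Proof. by []. Qed.

Lemma connSSE n k :
  conn n.+1 k.+1 = (3 * n%:R + 1) / (3 * k%:R + 1) * conn n k.
Proof. by []. Qed.

Lemma conn_small n k : (n < k)%N -> conn n k = 0.
Proof. by elim: n k => [|n IH] [|k] //= nk; rewrite IH ?mulr0. Qed.

Lemma conn0 k : conn 0 k = (k == 0%N)%:R.
Proof. by case: k. Qed.

Arguments conn : simpl never.

Lemma connSS n k :
  (3 * k%:R + 1) * conn n.+1 k.+1 = (3 * n%:R + 1) * conn n k.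
Proof.
have k0 := ler0n R k; rewrite connSSE; field.
by rewrite gt_eqF//; lra.
Qed.

(** Raising n multiplies the Pochhammer quotient by (n + 1/3)/(n + 1 - k). In multiplied-out form
    this persists for k > n; at k = n + 1 the left factor vanishes. *)
Lemma connSl n k :
  3 * (n%:R + 1 - k%:R) * conn n.+1 k = (3 * n%:R + 1) * conn n k.
Proof.
elim: n k => [|n IH] [|k].
- by rewrite connS0E conn0; field.
- by rewrite connSSE !conn0; case: k => [|k] /=; ring.
- have n0 := ler0n R n.+1; rewrite (connS0E n.+1); field.
  by rewrite gt_eqF//; lra.
- have := IH k; rewrite (connSSE n.+1) (connSSE n k).
  have n0 := ler0n R n; have k0 := ler0n R k => e.
  apply: (mulfI (_ : 3 * k%:R + 1 != 0)); first by rewrite gt_eqF//; lra.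
  transitivity ((3 * n.+1%:R + 1) * (3 * (n%:R + 1 - k%:R) * conn n.+1 k)).
    by rewrite -[n.+1%:R]natr1; field; rewrite gt_eqF//; lra.
  by rewrite e -[n.+1%:R]natr1; field; rewrite gt_eqF//; lra.
Qed.

Lemma connSr n k :
  (3 * k%:R + 1) * conn n k.+1 = 3 * (n%:R - k%:R) * conn n k.
Proof.
have n0 := ler0n R n.
apply: (mulfI (_ : 3 * n%:R + 1 != 0)); first by rewrite gt_eqF//; lra.
have := connSl n k.+1; have := connSS n k; rewrite -[k.+1%:R]natr1 => e1 e2.
transitivity (3 * (n%:R - k%:R) * ((3 * k%:R + 1) * conn n.+1 k.+1)).
  by rewrite mulrCA -e2; ring.
by rewrite e1; ring.
Qed.

(** Joint induction: [oddP_rec] yields the next even expansion, then [evenP_rec] the next odd one.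
    Each recurrence is used with sign 1 on the left and -1 on the right, and comparing coefficients
    leaves contiguous relations for [conn]. *)
Lemma connection n :
  evenP 1 n = \sum_(k < n.+1) conn n k *: evenP (-1) k /\
  oddP 1 n = \sum_(k < n.+1) conn n.+1 k.+1 *: oddP (-1) k.
Proof.
have c3 k (p : R) : 0 < p -> 3 * k%:R + p != 0 :> R.
  by have := ler0n R k => *; rewrite gt_eqF//; lra.
(* The expansion of [oddP 1 m.-1] is padded with its zero term k = m, so that all sums run over k <=
   m. *)
have stepO m : evenP 1 m = \sum_(k < m.+1) conn m k *: evenP (-1) k ->
    (3 * m%:R) *: oddP 1 m.-1 =
      (3 * m%:R) *: \sum_(k < m.+1) conn m k.+1 *: oddP (-1) k ->
    oddP 1 m = \sum_(k < m.+1) conn m.+1 k.+1 *: oddP (-1) k.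
  move=> eE eO; apply: (scalerI (c3 m 2 _)); first by [].
  have /esym/eqP := evenP_rec 1 m; rewrite mul1r subr_eq => /eqP ->.
  rewrite eO eE mulr_sumr.
  have -> : \sum_(i < m.+1) 'X * (conn m i *: evenP (-1) i) =
    \sum_(k < m.+1) ((3 * k%:R + 2) * conn m k) *: oddP (-1) k +
    \sum_(k < m.+1) ((3 * k%:R + 3) * conn m k.+1) *: oddP (-1) k.
    rewrite [X in _ = _ + X]big_ord_recr/= conn_small// mulr0 scale0r addr0.
    transitivity (\sum_(k < m.+1) ((3 * k%:R + 2) * conn m k) *: oddP (-1) k +
      \sum_(k < m.+1) (3 * k%:R * conn m k) *: oddP (-1) k.-1).
      rewrite -big_split/=; apply: eq_bigr => k _.
      rewrite -scalerAr evenP_rec mulN1r scaleNr opprK scalerDr !scalerA.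
      by rewrite !(mulrC (conn m k)).
    congr (_ + _); rewrite big_ord_recl/= mulr0 mul0r scale0r add0r.
    apply: eq_bigr => k _; rewrite /bump/= add1n add0n.
    by congr ((_ * _) *: _); ring.
  rewrite !scaler_sumr -!big_split/=; apply: eq_bigr => k _.
  rewrite !scalerA -!scalerDl; congr (_ *: _).
  apply: (mulfI (c3 k 1 _)) => //.
  have e1 := connSS m k; have e2 := connSr m k.
  have -> : (3 * k%:R + 1) * ((3 * k%:R + 2) * conn m k +
      (3 * k%:R + 3) * conn m k.+1 + 3 * m%:R * conn m k.+1) =
      (3 * k%:R + 2) * (3 * k%:R + 1) * conn m k +
      (3 * k%:R + 3 + 3 * m%:R) * ((3 * k%:R + 1) * conn m k.+1) by ring.
  rewrite [RHS]mulrCA e1 e2; ring.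
elim: n => [|n [eE eO]].
  rewrite !big_ord1 connSSE !conn0 !evenP0 scale1r; split=> //.
  rewrite /oddP !signedPS0 mulr0 add0r divff// mulr1.
  by rewrite scale1r.
have eE' : evenP 1 n.+1 = \sum_(k < n.+2) conn n.+1 k *: evenP (-1) k.
  apply: (@scalerI _ _ ((3 * n%:R + 3) * (3 * n%:R + 4))).
    by rewrite mulf_neq0// c3.
  have /esym/eqP := oddP_rec 1 n; rewrite mul1r subr_eq => /eqP ->.
  rewrite eO eE mulr_sumr.
  have -> : \sum_(k < n.+1) 'X * (conn n.+1 k.+1 *: oddP (-1) k) =
    \sum_(k < n.+2) (3 * k%:R * (3 * k%:R + 1) * conn n.+1 k) *: evenP (-1) k +
    \sum_(k < n.+2) ((3 * k%:R + 1) * (3 * k%:R + 2) * conn n.+1 k.+1)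
      *: evenP (-1) k.
    rewrite [X in _ = _ + X]big_ord_recr/= conn_small// mulr0 scale0r addr0.
    rewrite [X in _ = X + _]big_ord_recl/= mulr0 !mul0r scale0r add0r.
    rewrite -big_split/=; apply: eq_bigr => k _.
    rewrite -scalerAr oddP_rec mulN1r scaleNr opprK scalerDr !scalerA.
    congr (_ *: evenP _ _ + _ *: evenP _ _); rewrite mulrC//.
    by rewrite /bump/= add1n; congr (_ * _); ring.
  (* The contribution of [evenP 1 n] is rewritten through [conn n.+1 k] by [connSl]; the factor n +
     1 - k kills the added term k = n + 1. *)
  rewrite scaler_sumr [X in _ + X = _](_ : _ = \sum_(k < n.+2)
    (3 * (n%:R + 1 - k%:R) * (3 * n%:R + 2) * conn n.+1 k) *: evenP (-1) k).
    rewrite scaler_sumr -!big_split/=; apply: eq_bigr => k _.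
    rewrite scalerA -!scalerDl; congr (_ *: _).
    have := connSr n.+1 k; rewrite -[n.+1%:R]natr1 => e.
    have -> : (3 * k%:R + 1) * (3 * k%:R + 2) * conn n.+1 k.+1 =
      (3 * k%:R + 2) * ((3 * k%:R + 1) * conn n.+1 k.+1) by ring.
    rewrite e; ring.
  have e0 : n%:R + 1 - n.+1%:R = 0 :> R by ring.
  rewrite [RHS]big_ord_recr/= e0 mulr0 !mul0r scale0r addr0.
  apply: eq_bigr => k _; rewrite scalerA; congr (_ *: _).
  have := connSl n k => e.
  transitivity ((3 * n%:R + 2) * ((3 * n%:R + 1) * conn n k)); first by ring.
  by rewrite -e; ring.
split=> //; apply: stepO => //=.
rewrite eO [in RHS]big_ord_recr/= conn_small//.
by rewrite scale0r addr0.
Qed.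

End Connection.

(** The sequence v + w is nonincreasing: w is a potential whose decrease pays for the growth of
    v. *)
Lemma telescope_bound (R : realType) (v w : nat -> R) :
  (forall n, v n.+1 - v n <= w n - w n.+1) -> (forall n, 0 <= w n) ->
  forall n, v n <= v 0 + w 0.
Proof.
move=> vw w0 n; suff : v n <= v 0 + w 0 - w n by have := w0 n; lra.
elim: n => [|n IH]; first by lra.
by have := vw n; lra.
Qed.

(** * Growth in n of the coefficients of fixed degree *)

Section Coefficients.
Variable R : realType.

(** This is (2/3)_n/n!, the homogeneous solution of the recurrence for [ecoef]. *)
Definition dseq (n : nat) : R := \prod_(j < n) ((3 * j%:R + 2) / (3 * j%:R + 3)).

(** This is n!/(5/3)_n, of order n^(-2/3), the homogeneous solution of the recurrence for
    [ocoef]. *)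
Definition gseq (n : nat) : R := \prod_(j < n) ((3 * j%:R + 3) / (3 * j%:R + 5)).

Lemma dseqS n : dseq n.+1 = dseq n * ((3 * n%:R + 2) / (3 * n%:R + 3)).
Proof. by rewrite /dseq big_ord_recr. Qed.

Lemma gseqS n : gseq n.+1 = gseq n * ((3 * n%:R + 3) / (3 * n%:R + 5)).
Proof. by rewrite /gseq big_ord_recr. Qed.

Lemma dseq_gt0 n : 0 < dseq n.
Proof. by apply: prodr_gt0 => j _; have := ler0n R j => ?; apply: divr_gt0; lra. Qed.

Lemma gseq_gt0 n : 0 < gseq n.
Proof. by apply: prodr_gt0 => j _; have := ler0n R j => ?; apply: divr_gt0; lra. Qed.

(* d_n ~ n^(-1/3), so the summand is comparable to the decrement of d_n^2. *)
Lemma sum_dseq_sqr n : \sum_(j < n) (dseq j ^+ 2 / (3 * j%:R + 1)) <= 9 / 5.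
Proof.
pose v n : R := \sum_(j < n) (dseq j ^+ 2 / (3 * j%:R + 1)).
(* The constant is forced at n = 0, where the decrement 9/5 (1 - 4/9) equals the summand 1. *)
pose w n : R := 9 / 5 * dseq n ^+ 2.
have -> : 9 / 5 = v 0 + w 0 :> R.
  by rewrite /v /w big_ord0 /dseq big_ord0 expr1n mulr1 add0r.
apply: (@telescope_bound R v w) => {n} n; last first.
  by rewrite mulr_ge0// ?sqr_ge0//; lra.
rewrite /v big_ord_recr/= [X in X - _]addrC addrK /w dseqS.
have := ler0n R n; set x := n%:R => x0.
rewrite -subr_ge0; set D := dseq n.
have -> : 9 / 5 * D ^+ 2 - 9 / 5 * (D * ((3 * x + 2) / (3 * x + 3))) ^+ 2 -
    D ^+ 2 / (3 * x + 1) =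
    D ^+ 2 * ((13 * x * x + 11 * x) / (5 * (x + 1) ^+ 2 * (3 * x + 1))).
  by field; rewrite !gt_eqF//=; lra.
apply: mulr_ge0; first exact: sqr_ge0.
apply: divr_ge0; first by rewrite addr_ge0 ?mulr_ge0.
by rewrite !mulr_ge0 ?sqr_ge0//; lra.
Qed.

Let qseq n : R := gseq n / dseq n.+1.

Lemma qseq_decr n : qseq n / (3 * n%:R + 3) <= 5 / 3 * (qseq n - qseq n.+1).
Proof.
rewrite /qseq (dseqS n.+1) gseqS -[n.+1%:R]natr1.
have := ler0n R n; set x := n%:R => x0.
have := gseq_gt0 n; have := dseq_gt0 n.+1; set G := gseq n; set D := dseq n.+1.
move=> D0 G0; rewrite -subr_ge0.
have -> : 5 / 3 * (G / D -
    G * ((3 * x + 3) / (3 * x + 5)) /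
    (D * ((3 * (x + 1) + 2) / (3 * (x + 1) + 3)))) - G / D / (3 * x + 3) =
  G / D * ((6 * x * x + 20 * x + 10) / (3 * (3 * x + 5) ^+ 2 * (x + 1))).
  by field; rewrite !gt_eqF//=; lra.
apply: mulr_ge0; first by rewrite divr_ge0// ltW.
apply: divr_ge0; first by rewrite !addr_ge0 ?mulr_ge0.
by rewrite !mulr_ge0 ?sqr_ge0//; lra.
Qed.

(** Since (3n+2) d_n g_n = 2, this is d_n^2/2, which explains the same constant 9/5 in
    [yseq_decr]. *)
Let yseq n : R := dseq n / ((3 * n%:R + 2) * gseq n).

Lemma yseq_decr n : yseq n / (3 * n%:R + 1) <= 9 / 5 * (yseq n - yseq n.+1).
Proof.
rewrite /yseq dseqS gseqS -[n.+1%:R]natr1.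
have := ler0n R n; set x := n%:R => x0.
have := gseq_gt0 n; have := dseq_gt0 n; set G := gseq n; set D := dseq n.
move=> D0 G0; rewrite -subr_ge0.
have -> : 9 / 5 * (D / ((3 * x + 2) * G) -
     D * ((3 * x + 2) / (3 * x + 3)) /
     ((3 * (x + 1) + 2) * (G * ((3 * x + 3) / (3 * x + 5))))) -
   D / ((3 * x + 2) * G) / (3 * x + 1) =
  D / G * ((13 * x * x + 11 * x) /
           ((3 * x + 2) * (5 * (x + 1) ^+ 2 * (3 * x + 1)))).
  by field; rewrite !gt_eqF//=; lra.
apply: mulr_ge0; first by rewrite divr_ge0// ltW.
apply: divr_ge0; first by rewrite addr_ge0 ?mulr_ge0.
by rewrite !mulr_ge0 ?sqr_ge0//; lra.
Qed.

(** This equals sqrt(3n+1) |b_{k,2n}|. *)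
Definition ecoef n k : R := (3 * n%:R + 1) * (evenP 1 n)`_k.

Definition ocoef n k : R := (oddP 1 n)`_k.

(** Variation of constants: dividing by the homogeneous solution leaves a nonnegative increment,
    driven by the even coefficient of one degree less. *)
Lemma ocoef_rec n k :
  ocoef n.+1 k.+1 / gseq n.+1 = ocoef n k.+1 / gseq n +
    ecoef n.+1 k / ((3 * n%:R + 4) * ((3 * n%:R + 5) * gseq n.+1)).
Proof.
have /(congr1 (fun p : {poly R} => p`_k.+1)) := evenP_rec R 1 n.+1.
rewrite coefXM coefB !coefZ /= -/(ocoef _ _) -/(ocoef _ _).
rewrite gseqS /ecoef -[n.+1%:R]natr1.
have := ler0n R n; set x := n%:R => x0; have G0 := gseq_gt0 n.
set a := ocoef n.+1 _; set b := ocoef n _; set c := (evenP 1 n.+1)`_k => ->.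
by field; rewrite !gt_eqF//=; lra.
Qed.

Lemma ecoef_rec n k : ecoef n.+1 k / dseq n.+1 = ecoef n k / dseq n +
  (if k is k'.+1 then ocoef n k' else 0) / ((3 * n%:R + 3) * dseq n.+1).
Proof.
have /(congr1 (fun p : {poly R} => p`_k)) := oddP_rec R 1 n.
rewrite coefXM coefB !coefZ /= -/(ocoef _ _).
have -> : (if k == 0%N then 0 else ocoef n k.-1) =
  (if k is k'.+1 then ocoef n k' else 0) by case: k.
rewrite dseqS /ecoef -[n.+1%:R]natr1.
have := ler0n R n; set x := n%:R => x0; have G0 := dseq_gt0 n.
set a := (evenP 1 n.+1)`_k; set c := (evenP 1 n)`_k => ->.
by field; rewrite !gt_eqF//=; lra.
Qed.

Lemma ecoef0 n : ecoef n 0 = dseq n.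
Proof.
have d0 m : dseq m != 0 by rewrite gt_eqF// dseq_gt0.
suff : ecoef n 0 / dseq n = 1 by move/(canRL (divfK (d0 n))); rewrite mul1r.
elim: n => [|n IH].
  by rewrite /ecoef evenP0 coefC /dseq big_ord0 mulr0 add0r mul1r divr1.
by rewrite ecoef_rec IH mul0r addr0.
Qed.

Lemma evenP_ge0 n k : 0 <= (evenP 1 n : {poly R})`_k.
Proof.
rewrite evenP.unlock coefZ mulr_ge0 ?invr_ge0 ?sqrtr_ge0//.
by apply: absP_ge0; exact: bstar_gt0.
Qed.

Lemma ecoef_ge0 n k : 0 <= ecoef n k.
Proof. by rewrite mulr_ge0 ?evenP_ge0// addr_ge0 ?mulr_ge0. Qed.

Lemma ocoef_ge0 n k : 0 <= ocoef n k.
Proof. by apply: absP_ge0; exact: bstar_gt0. Qed.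

Lemma ecoef_diag_gt0 n : 0 < ecoef n n.*2.
Proof.
apply: mulr_gt0; first by rewrite ltr_wpDl ?mulr_ge0.
rewrite evenP.unlock coefZ mulr_gt0 ?invr_gt0 ?sqrt3D1_gt0//.
by apply: absP_lead_gt0; exact: bstar_gt0.
Qed.

Lemma ecoef_nondecreasing k m n : (m <= n)%N ->
  ecoef m k / dseq m <= ecoef n k / dseq n.
Proof.
elim: n => [|n IH]; first by rewrite leqn0 => /eqP ->.
rewrite leq_eqVlt => /orP[/eqP -> //|/IH /le_trans]; apply.
rewrite ecoef_rec lerDl divr_ge0//; first by case: (k) => // j; exact: ocoef_ge0.
have := ler0n R n; have := dseq_gt0 n.+1 => *; apply: mulr_ge0; lra.
Qed.

(** Induction on the degree: the bound for odd polynomials at k controls the even ones at k + 1, and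
    conversely. The increments are dominated by decrements of multiples of [qseq] and [yseq], so
    they telescope to a bound uniform in n. *)
Lemma coef_bound k :
  (exists2 K : R, 0 <= K & forall n, ecoef n k <= K * dseq n) /\
  (exists2 K : R, 0 <= K & forall n, ocoef n k <= K * gseq n).
Proof.
elim: k => [|k [[K K0 Ke] [K' K'0 Ko]]]; split.
- by exists 1 => // n; rewrite ecoef0 mul1r.
- exists 0 => // n; rewrite mul0r /ocoef /oddP signedP_parity//.
  by rewrite addn0 /= odd_double.
- pose v n : R := ecoef n k.+1 / dseq n; pose w n := K' * (5 / 3 * qseq n).
  have w0 n : 0 <= w n.
    apply: mulr_ge0 => //; apply: mulr_ge0; first by lra.
    by apply: divr_ge0; rewrite ltW ?gseq_gt0 ?dseq_gt0.
  have vw n : v n.+1 - v n <= w n - w n.+1.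
    rewrite /v ecoef_rec [X in X - _]addrC addrK /w -!mulrBr.
    apply: le_trans (ler_wpM2l K'0 (qseq_decr n)).
    have := ler0n R n => n0; have := dseq_gt0 n.+1 => D0.
    have -> : K' * (qseq n / (3 * n%:R + 3)) =
      K' * gseq n / ((3 * n%:R + 3) * dseq n.+1).
      by rewrite /qseq; field; rewrite !gt_eqF//=; lra.
    rewrite ler_pM2r// invr_gt0; apply: mulr_gt0; lra.
  have := telescope_bound R v w vw w0 => vb; exists (v 0 + w 0).
    by rewrite addr_ge0// /v divr_ge0 ?ecoef_ge0// ltW// dseq_gt0.
  by move=> n; rewrite -ler_pdivrMr ?dseq_gt0//; exact: vb.
(* The potential is shifted because the increment of v involves [ecoef] at n + 1. *)
- pose v n : R := ocoef n k.+1 / gseq n; pose w n := K * (9 / 5 * yseq n.+1).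
  have w0 n : 0 <= w n.
    have := ler0n R n.+1; have := gseq_gt0 n.+1; have := dseq_gt0 n.+1 => *.
    apply: mulr_ge0 => //; apply: mulr_ge0; first by lra.
    by apply: divr_ge0; [lra | apply: mulr_ge0; lra].
  have vw n : v n.+1 - v n <= w n - w n.+1.
    rewrite /v ocoef_rec [X in X - _]addrC addrK /w -!mulrBr.
    apply: le_trans (ler_wpM2l K0 (yseq_decr n.+1)).
    have := ler0n R n => n0; have := gseq_gt0 n.+1 => D0.
    have -> : K * (yseq n.+1 / (3 * n.+1%:R + 1)) =
      K * dseq n.+1 / ((3 * n%:R + 4) * ((3 * n%:R + 5) * gseq n.+1)).
      by rewrite /yseq -[n.+1%:R]natr1; field; rewrite !gt_eqF//=; lra.
    rewrite ler_pM2r// invr_gt0 !mulr_gt0//; lra.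
  have := telescope_bound R v w vw w0 => vb; exists (v 0 + w 0).
    by rewrite addr_ge0// /v divr_ge0 ?ocoef_ge0// ltW// gseq_gt0.
  by move=> n; rewrite -ler_pdivrMr ?gseq_gt0//; exact: vb.
Qed.

End Coefficients.

(** * Splitting by parity and absolute convergence *)

Lemma sum_double (V : zmodType) (F : nat -> V) n :
  \sum_(i < n.*2) F i = \sum_(i < n) F i.*2 + \sum_(i < n) F i.*2.+1.
Proof.
elim: n => [|n IH]; first by rewrite !big_ord0 addr0.
by rewrite doubleS !big_ord_recr/= IH addrACA -addrA.
Qed.

Lemma abs_convergentP (R : realType) (u : nat -> R) :
  abs_convergent u <-> exists M, forall n, \sum_(i < n) `|u i| <= M.
Proof.
have mono : nondecreasing_seq [normed series u].
  by apply: nondecreasing_series => i _ _ /=; exact: normr_ge0.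
have E n : [normed series u] n = \sum_(i < n) `|u i|.
  by rewrite /= /series/= big_mkord.
split=> [cu|[M uM]].
  by exists (limn [normed series u]) => n; rewrite -E; exact: nondecreasing_cvgn_le.
apply: nondecreasing_is_cvgn => //.
by exists M => _ [n _ <-]; rewrite E.
Qed.

Lemma abs_convergent_double (R : realType) (u : nat -> R) :
  abs_convergent u -> abs_convergent (fun n => u n.*2).
Proof.
move=> /abs_convergentP[M uM]; apply/abs_convergentP; exists M => n.
apply: le_trans (uM n.*2); rewrite (sum_double _ (fun i => `|u i|)).
by rewrite lerDl sumr_ge0.
Qed.

(** * Kernel coefficients and the divergent comparison series *)

Section Kernel.
Variable R : realType.

(** Convergence must be proved first, since [kcoef] is a limit. The absolute terms vanish at odd
    indices, and [coef_bound] with [sum_dseq_sqr] bounds their partial sums; L is the sum of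
    absolute values. *)
Lemma kcoef_even k l : exists2 L : R,
  kcoef (bstar R) k.*2 l.*2 = (-1) ^+ (k + l) * L &
  forall N, \sum_(n < N)
    (ecoef R n k.*2 * ecoef R n l.*2 / (3 * n%:R + 1)) <= L.
Proof.
pose T n : R := (absP (bstar R) n)`_k.*2 * (absP (bstar R) n)`_l.*2.
have T0 n : 0 <= T n by rewrite mulr_ge0// absP_ge0//; exact: bstar_gt0.
have Teven n : T n.*2 = ecoef R n k.*2 * ecoef R n l.*2 / (3 * n%:R + 1).
  rewrite /T !signedP_even !coefZ mulrACA -expr2 sqr_sqrt3D1 /ecoef.
  by have := ler0n R n => n0; field; rewrite gt_eqF//; lra.
have Todd n : T n.*2.+1 = 0.
  rewrite /T signedP_parity ?mul0r//.
  by rewrite addSn /= -doubleD odd_double.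
have Tsum N : \sum_(n < N.*2) T n =
    \sum_(n < N) (ecoef R n k.*2 * ecoef R n l.*2 / (3 * n%:R + 1)).
  rewrite sum_double [X in _ + X]big1 ?addr0; last by move=> i _; exact: Todd.
  by apply: eq_bigr => n _; exact: Teven.
pose m := maxn k.*2 l.*2; pose S N := \sum_(m <= n < N) T n.
have Tsmall n : (n < m)%N -> T n = 0.
  rewrite /m leq_max => /orP[] h; rewrite /T.
    by rewrite nth_default ?mul0r// (leq_trans (size_signedP _ _ _ _)).
  by rewrite [X in _ * X]nth_default ?mulr0// (leq_trans (size_signedP _ _ _ _)).
have SE N : S N = \sum_(n < N) T n.
  rewrite /S -(big_mkord xpredT T); have [mN|Nm] := leqP m N.
    rewrite [RHS](big_cat_nat (n := m))//= [X in _ = X + _]big_nat_cond [X in _ = X + _]big1 ?add0r//.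
    by move=> i; rewrite andbT => /Tsmall.
  rewrite [LHS]big_geq ?(ltnW Nm)// [RHS]big_nat_cond big1// => i.
  by case/andP=> /andP[_ iN] _; rewrite Tsmall// (ltn_trans iN).
have Smono : nondecreasing_seq S.
  apply/nondecreasing_seqP => N; rewrite !SE big_ord_recr/= lerDl//.
have Scvg : cvgn S.
  apply: nondecreasing_is_cvgn => //.
  have [[K K0 eK] _] := coef_bound R k.*2; have [[K' K'0 eK'] _] := coef_bound R l.*2.
  exists (K * K' * (9 / 5)) => _ [N _ <-].
  (* An even cutoff lets the sum split by parity. *)
  apply: (@le_trans _ _ (S N.*2)).
    by apply: Smono; rewrite -addnn leq_addr.
  rewrite SE Tsum.
  apply: (le_trans _ (ler_wpM2l (mulr_ge0 K0 K'0) (sum_dseq_sqr R N))).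
  rewrite mulr_sumr; apply: ler_sum => n _; rewrite [leRHS]mulrA.
  have := ler0n R n => n0.
  rewrite ler_pM2r ?invr_gt0; last by lra.
  rewrite expr2 [leRHS]mulrACA.
  by apply: ler_pM; rewrite ?ecoef_ge0 ?eK ?eK'.
exists (limn S) => [|N].
  rewrite /kcoef; apply/cvg_lim => //.
  rewrite (_ : (fun N => _) = (fun N => (-1) ^+ (k + l) * S N)).
    exact: cvgMr.
  apply/funext => N; rewrite /S mulr_sumr; apply: eq_bigr => n _.
  by rewrite coef_orthP_even//; exact: bstar_gt0.
by rewrite -Tsum -SE; exact: nondecreasing_cvgn_le.
Qed.

Lemma conn0_ge0 n : 0 <= conn R n 0.
Proof.
elim: n => [|n IH]; first by rewrite conn0.
by rewrite connS0E mulr_ge0// divr_ge0// addr_ge0// mulr_ge0.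
Qed.

(** The quantity n (1/3)_n (2/3)_n / n!^2 is nondecreasing and equals 2/9 at n = 1. *)
Lemma dseq_conn_ge n : 2 / 9 * n.+1%:R^-1 <= dseq R n.+1 * conn R n.+1 0.
Proof.
suff h : 2 / 9 <= n.+1%:R * (dseq R n.+1 * conn R n.+1 0).
  by rewrite ler_pdivrMr ?ltr0n// [leRHS]mulrC.
elim: n => [|n IH].
  rewrite dseqS connS0E conn0 /dseq big_ord0 eqxx !mulr0 !add0r.
  by rewrite mulr1; lra.
apply: (le_trans IH); rewrite (dseqS _ n.+1) (connS0E _ n.+1).
have := mulr_ge0 (ltW (dseq_gt0 R n.+1)) (conn0_ge0 n.+1).
set D := dseq R n.+1; set C := conn R n.+1 0; move=> DC0.
rewrite -[n.+2%:R]natr1 -[n.+1%:R]natr1.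
have := ler0n R n; set x := n%:R => x0; rewrite -subr_ge0.
have -> : (x + 1 + 1) * (D * ((3 * (x + 1) + 2) / (3 * (x + 1) + 3)) *
    ((3 * (x + 1) + 1) / (3 * (x + 1) + 3) * C)) - (x + 1) * (D * C) =
  D * C * (2 / (9 * (x + 2))).
  by field; rewrite !gt_eqF//=; lra.
by rewrite mulr_ge0// divr_ge0//; lra.
Qed.

Lemma sum_ecoef_conn_unbounded k A :
  exists N, A < \sum_(n < N) ecoef R n k.*2 * conn R n 0.
Proof.
pose F n := ecoef R n k.*2 * conn R n 0.
have F0 n : 0 <= F n by rewrite mulr_ge0 ?ecoef_ge0 ?conn0_ge0.
apply: contrapT => /forallNP bnd.
have Fbnd N : \sum_(n < N) F n <= A by rewrite leNgt; apply/negP; exact: bnd.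
(* At n = k this is a leading coefficient, hence positive; by monotonicity C d_n is a lower bound
   for all n >= k. *)
pose C := ecoef R k k.*2 / dseq R k.
have C0 : 0 < C by rewrite divr_gt0 ?ecoef_diag_gt0 ?dseq_gt0.
(* Here [harmonic n] is 1/(n+1), whence the shift in F; the indicator absorbs the first k terms. *)
have ph n : harmonic n <= (C * (2 / 9))^-1 * F n.+1 + (n < k)%:R :> R.
  have [nk|kn] := ltnP n k.
    have h1 : harmonic n <= 1 :> R by rewrite invf_le1 ?ler1n ?ltr0n.
    apply: (le_trans h1); rewrite lerDr mulr_ge0// invr_ge0 mulr_ge0//; lra.
  rewrite addr0 mulrC ler_pdivlMr; last by rewrite mulr_gt0//; lra.
  rewrite mulrC -mulrA.
  apply: (le_trans (ler_wpM2l (ltW C0) (dseq_conn_ge n))).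
  rewrite mulrA ler_wpM2r ?conn0_ge0// -ler_pdivlMr ?dseq_gt0//.
  by apply: ecoef_nondecreasing; exact: leqW.
have ind N : \sum_(n < N) (n < k)%:R <= k%:R :> R.
  suff : \sum_(n < N) (n < k)%:R <= (minn N k)%:R :> R.
    by move/le_trans; apply; rewrite ler_nat geq_minr.
  elim: N => [|N IH]; first by rewrite big_ord0.
  rewrite big_ord_recr/=; have [Nk|kN] := ltnP N k.
    by rewrite (minn_idPl Nk) -natr1 lerD2r (le_trans IH)// ler_nat geq_minl.
  by rewrite addr0 (le_trans IH)// ler_nat leq_min geq_minr (leq_trans (geq_minr _ _))// leqW.
apply: (@dvg_harmonic R); apply: nondecreasing_is_cvgn.
  by apply: nondecreasing_series => n _ _; exact: harmonic_ge0.
exists ((C * (2 / 9))^-1 * A + k%:R) => _ [N _ <-].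
rewrite /series/= big_mkord.
apply: (@le_trans _ _ (\sum_(n < N) ((C * (2 / 9))^-1 * F n.+1 + (n < k)%:R))).
  by apply: ler_sum => n _; exact: ph.
rewrite big_split/= -mulr_sumr; apply: lerD; last exact: ind.
apply: ler_wpM2l; first by rewrite invr_ge0 mulr_ge0 ?(ltW C0)//; lra.
by apply: le_trans (Fbnd N.+1); rewrite big_ord_recl lerDr.
Qed.

(* Cauchy-Schwarz against the coefficients of index 0, whose squares sum to at
   most 9/5 by [sum_dseq_sqr]. *)
Lemma ccoef_ge l N : (\sum_(n < N)
    (ecoef R n 0 * ecoef R n l.*2 / (3 * n%:R + 1))) / 2 <=
  ccoef (bstar R) l.*2.
Proof.
have [L kL LN] := kcoef_even l l; have := LN N.
set X := \sum_(n < N) (ecoef R n 0 * _ / _); set Y := \sum_(n < N) _ => YL.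
rewrite /ccoef kL -signr_odd addnn odd_double mul1r.
(* This expands the sum of (e - t d)^2/(3n+1) >= 0 at t = X/2. With the bound 9/5 it gives Y >=
   (11/20) X^2 >= (X/2)^2. *)
have YX : 0 <= Y - 2 * (X / 2) * X + (X / 2) ^+ 2 *
    (\sum_(n < N) (dseq R n ^+ 2 / (3 * n%:R + 1))).
  rewrite /Y {2}/X !mulr_sumr -sumrB -big_split/=; apply: sumr_ge0 => n _.
  rewrite ecoef0; set e := ecoef R n l.*2; set d := dseq R n; set t := X / 2.
  have -> : e * e / (3 * n%:R + 1) - 2 * t * (d * e / (3 * n%:R + 1)) +
    t ^+ 2 * (d ^+ 2 / (3 * n%:R + 1)) = (e - t * d) ^+ 2 / (3 * n%:R + 1).
    by have := ler0n R n => n0; field; rewrite gt_eqF//; lra.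
  by rewrite divr_ge0 ?sqr_ge0// addr_ge0// mulr_ge0.
have H := ler_wpM2l (sqr_ge0 (X / 2)) (sum_dseq_sqr R N).
have XL : (X / 2) ^+ 2 <= L.
  have := sqr_ge0 X; rewrite !expr2 in YX H * => *; lra.
apply: (le_trans (ler_norm _)); rewrite -sqrtr_sqr ler_sqrt//.
exact: le_trans (sqr_ge0 _) XL.
Qed.

End Kernel.

(** * Moments of the measure and divergence *)

Section Moments.
Context (R : realType) (mu : probability (measurableTypeR R) R).
Hypothesis hmu : orthonormal_measure (bstar R) mu.
Let s := moment mu.

Lemma moment_horner (p : {poly R}) n : (size p <= n)%N ->
  \int[mu]_x p.[x] = \sum_(i < n) p`_i * s i.
Proof.
move=> pn.
have int_sum m : mu.-integrable setT
    (EFin \o (fun x : R => \sum_(i < m) p`_i * x ^+ i)) /\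
    \int[mu]_x (\sum_(i < m) p`_i * x ^+ i) = \sum_(i < m) p`_i * s i.
  have iX (i : nat) : mu.-integrable setT (EFin \o (fun x : R => p`_i * x ^+ i)).
    exact: (integrableZl _ (p`_i) (hmu.1 i)).
  elim: m => [|m [IH1 IH2]].
    rewrite big_ord0; split.
      rewrite (_ : _ \o _ = cst 0%E); first exact: integrable0.
      by apply/funext => x /=; rewrite big_ord0.
    rewrite (_ : (fun x => _) = cst 0) ?Rintegral_cst ?mul0r//.
    by apply/funext => x /=; rewrite big_ord0.
  split.
    pose f (x : R) := \sum_(i < m) p`_i * x ^+ i.
    pose g (x : R) := p`_m * x ^+ m.
    rewrite (_ : _ \o _ = ((EFin \o f) \+ (EFin \o g))%E).
      by apply: integrableD => //; exact: iX.
    by apply/funext => x /=; rewrite big_ord_recr/= EFinD.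
  under eq_Rintegral do rewrite big_ord_recr/=.
  rewrite RintegralD// IH2 RintegralZl//; last exact: hmu.1.
  by rewrite big_ord_recr.
rewrite -(int_sum n).2; apply: eq_Rintegral => x _.
exact: horner_coef_wide.
Qed.

Lemma moment_orthP n N : (n < N)%N ->
  \sum_(i < N) (orthP (bstar R) n)`_i * s i = (n == 0%N)%:R.
Proof.
move=> nN; rewrite -moment_horner; last first.
  by rewrite orthP_signedP; exact: leq_trans (size_signedP _ _ _ _) nN.
rewrite eq_sym -(hmu.2 0%N n); apply: eq_Rintegral => x _.
by rewrite /= hornerC mul1r.
Qed.

(** Integrating the connection formula leaves only k = 0, because P_{2k} is orthogonal to 1 for k >
    0. Any N > n reaches the degree 2n. *)
Lemma moment_ecoef n N : (n < N)%N ->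
  \sum_(l < N) ecoef R n l.*2 * s l.*2 = (3 * n%:R + 1) * conn R n 0.
Proof.
move=> nN; under eq_bigr do rewrite -mulrA.
rewrite -mulr_sumr; congr (_ * _).
transitivity (\sum_(i < N.*2) (evenP 1 n)`_i * s i).
  rewrite (sum_double _ (fun i => (evenP 1 n)`_i * s i)) [X in _ + X]big1 ?addr0//.
  move=> i _; rewrite evenP.unlock coefZ signedP_parity ?mulr0 ?mul0r//.
  by rewrite -addnn oddD /= addnn !odd_double.
rewrite (connection R n).1.
under eq_bigr do rewrite coef_sum mulr_suml.
rewrite exchange_big/= big_ord_recl [X in _ + X]big1 ?addr0; last first.
  move=> k _; under eq_bigr do rewrite evenP.unlock !coefZ -orthP_signedP -!mulrA.
  rewrite -!mulr_sumr moment_orthP ?double_eq0 ?mulr0//.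
  by rewrite ltn_double (leq_trans _ nN)// ltnS.
under eq_bigr do rewrite evenP.unlock !coefZ -orthP_signedP -!mulrA.
rewrite -!mulr_sumr moment_orthP ?double_gt0 ?(leq_trans _ nN)//.
by rewrite mulr0 add0r sqrtr1 invr1 !mulr1.
Qed.

Lemma moment_even_ge0 l : 0 <= s l.*2.
Proof. by apply: Rintegral_ge0 => x _; rewrite -mul2n exprM exprn_ge0// sqr_ge0. Qed.

Lemma moment0 : s 0 = 1.
Proof.
rewrite -[RHS](hmu.2 0%N 0%N); apply: eq_Rintegral => x _.
by rewrite expr0 hornerC mulr1.
Qed.

(** Normalisation of P_1 = x/2. The inequality s_2 >= s_0 makes the even moments nondecreasing. *)
Lemma moment2 : s 2 = 4.
Proof.
have b0 : bstar R 0 = 2 by rewrite (bstar_doubleE R 0) mulr0 !add0r sqrtr1 mulr1.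
have := hmu.2 1%N 1%N; rewrite eqxx.
under eq_Rintegral do rewrite /= subr0 mulr1 hornerZ hornerX b0 mulrACA -expr2.
rewrite RintegralZl//; last exact: (hmu.1 2%N).
rewrite -/(s 2) => e; have -> : s 2 = 4 * (2^-1 / 2 * s 2) by field.
by rewrite e mulr1.
Qed.

(** With y = x^2 the difference is (y^l - 1)(y - 1), and its factors never have opposite signs.
    Integration gives s_{2l+2} - s_{2l} >= s_2 - s_0. *)
Lemma even_expr_ge (x : R) l :
  x ^+ l.*2 + x ^+ 2 <= x ^+ l.+1.*2 + x ^+ 0.
Proof.
have E m : x ^+ m.*2 = (x ^+ 2) ^+ m by rewrite -mul2n exprM.
rewrite (E l) (E l.+1) (exprSr (x ^+ 2)) expr0.
have := sqr_ge0 x; move: (x ^+ 2) => y y0; rewrite -subr_ge0.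
have -> : y ^+ l * y + 1 - (y ^+ l + y) = (y ^+ l - 1) * (y - 1) by ring.
have [y1|y1] := lerP 1 y.
  by rewrite mulr_ge0// subr_ge0// exprn_ege1.
by rewrite mulr_le0// subr_le0 ?(ltW y1)// exprn_ile1// ltW.
Qed.

Lemma moment_even_leS l : s l.*2 <= s l.+1.*2.
Proof.
have : s l.*2 + s 2 <= s l.+1.*2 + s 0.
  rewrite -!RintegralD//; try exact: hmu.1.
  apply: le_Rintegral => //.
  - by rewrite (_ : _ \o _ = ((fun x : R => (x ^+ l.*2)%:E) \+
      (fun x : R => (x ^+ 2)%:E))%E)//; apply: integrableD => //; exact: hmu.1.
  - by rewrite (_ : _ \o _ = ((fun x : R => (x ^+ l.+1.*2)%:E) \+
      (fun x : R => (x ^+ 0)%:E))%E)//; apply: integrableD => //; exact: hmu.1.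
  by move=> x _; exact: even_expr_ge.
rewrite moment0 moment2; lra.
Qed.

Lemma moment_even_le l m : s l.*2 <= s (l.*2 + m.*2).
Proof.
rewrite -doubleD; elim: m => [|m IH]; first by rewrite addn0.
by rewrite addnS (le_trans IH)// moment_even_leS.
Qed.

(** A finite form of Tonelli: with both sums cut at the same N, every inner moment sum is already
    complete. *)
Lemma sum_kernel_moment k N :
  \sum_(l < N) (\sum_(n < N)
    (ecoef R n k.*2 * ecoef R n l.*2 / (3 * n%:R + 1))) * s l.*2 =
  \sum_(n < N) ecoef R n k.*2 * conn R n 0.
Proof.
under eq_bigr do rewrite mulr_suml.
rewrite exchange_big/=; apply: eq_bigr => n _.
have n0 : 3 * n%:R + 1 != 0 :> R.
  by have := ler0n R n => n0; rewrite gt_eqF//; lra.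
transitivity (ecoef R n k.*2 / (3 * n%:R + 1) *
    (\sum_(l < N) ecoef R n l.*2 * s l.*2)).
  by rewrite mulr_sumr; apply: eq_bigr => l _; ring.
by rewrite moment_ecoef//; field.
Qed.

(** In the partial sum up to N, |a_{2k,2l}| is bounded below by its own truncation at N and
    s_{2l+2m} by s_{2l}; the resulting square sums are unbounded. *)
Lemma kcoef_moment_dvg k m :
  ~ abs_convergent (fun l => kcoef (bstar R) k.*2 l.*2 * s (l.*2 + m.*2)%N).
Proof.
move=> /abs_convergentP[M kM].
have [N MN] := sum_ecoef_conn_unbounded R k M.
have := lt_le_trans MN (le_trans _ (kM N)); rewrite ltxx => /(_ _)/negP; apply=> //.
rewrite -sum_kernel_moment; apply: ler_sum => l _.
have [L -> LN] := kcoef_even R k l.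
have L0 : 0 <= L by have := LN 0%N; rewrite big_ord0.
rewrite !normrM normrX normrN1 expr1n mul1r ger0_norm//.
rewrite ger0_norm; last exact: le_trans (moment_even_ge0 l) (moment_even_le l m).
apply: ler_pM => //.
- apply: sumr_ge0 => n _; apply: divr_ge0; last by rewrite addr_ge0// mulr_ge0.
  by apply: mulr_ge0; exact: ecoef_ge0.
- exact: moment_even_ge0.
- exact: moment_even_le.
Qed.

Lemma cs_sum_pinfty : cs_sum (bstar R) s = +oo%E.
Proof.
have t0 n : 0 <= ccoef (bstar R) n.*2 * s n.*2.
  by rewrite mulr_ge0 ?sqrtr_ge0 ?moment_even_ge0.
(* The factor 2 compensates the 1/2 in [ccoef_ge]. *)
apply/eqyP => A A0; have [N AN] := sum_ecoef_conn_unbounded R 0 (2 * A).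
rewrite /cs_sum.
apply: le_trans (nneseries_lim_ge N _); last by move=> n _ _; rewrite lee_fin.
rewrite sumEFin lee_fin big_mkord.
have : A <= (\sum_(n < N) ecoef R n 0.*2 * conn R n 0) / 2 by lra.
move/le_trans; apply; rewrite -sum_kernel_moment mulr_suml.
apply: ler_sum => l _; rewrite mulrAC ler_wpM2r ?moment_even_ge0//.
exact: ccoef_ge.
Qed.

End Moments.

Theorem theorem6p1 (R : realType) (mu : probability (measurableTypeR R) R)
    (hmu : orthonormal_measure (bstar R) mu) :
  [/\ cs_sum (bstar R) (moment mu) = +oo%E,
      ~ property_cs (bstar R) (moment mu),
      (forall k m : nat, (1 <= m)%N ->
         ~ abs_convergent (fun l =>
             kcoef (bstar R) k.*2 l.*2 * moment mu (l.*2 + m.*2)%N)) &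
      ~ property_ac (bstar R) (moment mu)].
Proof.
split.
- exact: cs_sum_pinfty.
- by rewrite /property_cs cs_sum_pinfty.
- by move=> k m _; exact: kcoef_moment_dvg.
(* Restricting i = 0, j = 2 to even summation indices gives the case k = 0, m = 1. *)
- move=> /(_ 0%N 2%N)/abs_convergent_double.
  exact: (@kcoef_moment_dvg _ _ hmu 0 1).
Qed.
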